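(* Let $n\ge1$, $A=\{0,1,\ldots,n+1\}\subset\mathbb{Z}$ and $A'=\{0\}$. Let $\Sigma(A)\subset\mathbb{R}^A$ be the secondary polytope of $A$ and $\gamma_{A'}=e_0^\vee$ the linear function on $\mathbb{R}^A$ taking the coordinate indexed by $0\in A$. Then the monotone path polytope $\Sigma_{\gamma_{A'}}(\Sigma(A))$ is combinatorially equivalent to an $(n-1)$-dimensional cube.
   Context: $\{e_0,\ldots,e_{n+1}\}$ is the standard basis of $\mathbb{Z}^A$. The secondary polytope $\Sigma(A)$ (Gelfand-Kapranov-Zelevinsky) is the convex hull in $\mathbb{R}^A$ of the vectors $\varphi_T=\sum_{a\in A}\big(\sum_{\sigma\in T,\ a\in\mathrm{Vert}(\sigma)}\mathrm{length}(\sigma)\big)e_a$, where $T$ runs over the (regular) triangulations of $[0,n+1]$ with vertices in $A$. These triangulations are indexed by subsets $K\subset\{1,\ldots,n\}$, where $K$ is the set of interior vertices of the triangulation. For a polytope $P$ and a linear function $\gamma$ on $P$, the monotone path polytope $\Sigma_\gamma(P)$ is the Billera-Sturmfels fiber polytope of the projection $\gamma:P\to\gamma(P)\subset\mathbb{R}$. Two polytopes are combinatorially equivalent if their face lattices are isomorphic. *)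

(* Defs.v *)
From HB Require Import structures.
From mathcomp Require Import all_boot all_order all_algebra.
From mathcomp Require Import all_classical all_reals all_analysis.

Set Implicit Arguments.
Unset Strict Implicit.
Unset Printing Implicit Defensive.

Import Order.TTheory GRing.Theory Num.Theory.
Import numFieldNormedType.Exports.

Local Open Scope classical_set_scope.
Local Open Scope ring_scope.

Definition convex_hull (R : realType) (V : lmodType R) (X : set V) : set V :=
  smallest (@convex_set R V) X.

(* Faces are cut out by valid linear inequalities l x <= b, so that the empty
   face and P itself are faces. *)
Definition is_face (R : realType) (V : lmodType R) (P F : set V) : Prop :=
  exists (l : {scalar V}) (b : R),
    (forall x, P x -> l x <= b) /\ F = [set x | P x /\ l x = b].

Definition faces (R : realType) (V : lmodType R) (P : set V) : set (set V) :=
  [set F | is_face P F].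

(* An isomorphism of lattices is the same as an isomorphism of the underlying
   orders, here inclusion of faces. *)
Definition combinatorially_equivalent (R : realType) (V W : lmodType R)
    (P : set V) (Q : set W) : Prop :=
  exists f : set V -> set W,
    set_bij (faces P) (faces Q) f /\
    (forall F G, faces P F -> faces P G -> (F `<=` G <-> f F `<=` f G)).

Definition cube (R : realType) (m : nat) : set 'rV[R]_m :=
  [set x | forall i, 0 <= x 0 i <= 1].
Arguments cube R m : clear implicits.

Definition coord_form (R : realType) (m : nat) (i : 'I_m) (x : 'rV[R]_m) : R :=
  x 0 i.

Lemma coord_form_is_scalar (R : realType) (m : nat) (i : 'I_m) :
  scalar (@coord_form R m i).
Proof. by move=> a x y; rewrite /coord_form !mxE. Qed.

HB.instance Definition _ (R : realType) (m : nat) (i : 'I_m) :=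
  GRing.isLinear.Build R 'rV[R]_m R _ (@coord_form R m i)
    (@coord_form_is_scalar R m i).

(* A cell of a triangulation of the point configuration {0, ..., n + 1} is
   encoded by its two end points s.1 < s.2. *)
Definition vert (n : nat) (s : 'I_n.+2 * 'I_n.+2) : {set 'I_n.+2} :=
  [set s.1; s.2]%SET.

Definition segment (R : realType) (n : nat) (s : 'I_n.+2 * 'I_n.+2) : set R :=
  `[(s.1 : nat)%:R, (s.2 : nat)%:R]%classic.
Arguments segment R {n} s.

Definition seg_length (R : realType) (n : nat) (s : 'I_n.+2 * 'I_n.+2) : R :=
  (s.2 : nat)%:R - (s.1 : nat)%:R.

(* T is the set of maximal cells.  Two distinct ones must meet in a common
   face, which for segments is the set of their common vertices. *)
Definition is_triangulation (R : realType) (n : nat)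
    (T : {set 'I_n.+2 * 'I_n.+2}) : Prop :=
  [/\ forall s, s \in T -> (s.1 < s.2)%N,
      \bigcup_(s in [set` T]) segment R s = `[0, n.+1%:R]%classic &
      forall s t, s \in T -> t \in T -> s != t ->
        segment R s `&` segment R t =
        [set (a : nat)%:R | a in [set` vert s :&: vert t]%SET]].

Definition gkz_vector (R : realType) (n : nat)
    (T : {set 'I_n.+2 * 'I_n.+2}) : 'rV[R]_n.+2 :=
  \row_a \sum_(s in T | a \in vert s) seg_length R s.

Definition secondary_polytope (R : realType) (n : nat) : set 'rV[R]_n.+2 :=
  convex_hull [set gkz_vector R T | T in [set T | is_triangulation R T]].
Arguments secondary_polytope R n : clear implicits.

(* Sections of g : P -> g(P) are taken Borel measurable, as in the Minkowski
   integral of the fibers; continuous sections have the same averages. *)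
Definition is_section (R : realType) (m : nat) (P : set 'rV[R]_m)
    (g : {scalar 'rV[R]_m}) (s : R -> 'rV[R]_m) : Prop :=
  (forall i, measurable_fun (g @` P) (fun t => s t 0 i)) /\
  (forall t, (g @` P) t -> P (s t) /\ g (s t) = t).

(* The Billera-Sturmfels fiber polytope of g : P -> g(P): the average values of
   the sections.  Meaningful when g is not constant on P. *)
Definition monotone_path_polytope (R : realType) (m : nat) (P : set 'rV[R]_m)
    (g : {scalar 'rV[R]_m}) : set 'rV[R]_m :=
  [set \row_i ((\int[@lebesgue_measure R]_(t in g @` P) (s t 0 i)) /
               fine (@lebesgue_measure R (g @` P)))
   | s in [set s | is_section P g s]].

(* Main.v *)
Require Import Defs.
From HB Require Import structures.
From mathcomp Require Import all_boot all_order all_algebra.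
From mathcomp Require Import all_classical all_reals all_analysis measurable_realfun.
From mathcomp Require Import ring lra zify.

(** Write N = n + 1 and, for x in R^A, let height j x be the sum of the
    (j - i)^+ x_i.  As a function of j it is piecewise linear, vanishes at 0,
    has initial slope x_0 and second difference x_j at j.  On the vector of a
    triangulation with vertex set K it is the interpolation at K of the parabola
    j^2.  So every x in Sigma(A) gives a convex sequence with height j x >= j^2,
    and height 0 x = 0, height N x = N^2; the function gamma is the initial
    slope, and it ranges over [1, N].

    A section assigns to each slope t in [1, N] such a convex sequence with
    initial slope t, hence with height j >= max (j t, j^2) = j max (t, j).
    Averaging over t, the mean X of a section satisfies X_j >= 0 and
    height j X >= level j for 2 <= j <= n, where level j is the mean of
    j max (t, j), a cubic polynomial in j; for j = 1 and j = N the height of X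
    is forced to equal level j.  The cubic is strictly convex at 2, ..., n.
    Hence X_j = 0 and height j X = level j never hold together
    (lemma not_both_tight): these 2 (n - 1) inequalities are paired like the
    opposite facets of an (n - 1)-cube.

    Every one of the 2^(n-1) choices of one inequality in each pair is
    realized.  For K containing 0, 1 and N, start with the triangulation K at
    t = 1 and remove the first interior vertex repeatedly; moving along the
    corresponding edges of Sigma(A) gives a section which has x_j = 0 for j not
    in K, and height j = j max (t, j) for j in K (path_section).  Its mean is
    the vertex indexed by K.

    The means of the sections fill the whole polytope cut out by the
    inequalities (polyhedron_sub_average): they form a convex set containing the
    vertices, and from a point where some pair has no tight inequality one can
    move both ways along a hat function supported between neighbouring
    breakpoints until new inequalities become tight.

    Finally, the face lattice of a polyhedron only depends on the family of sets
    of inequalities that are simultaneously tight at some point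
    (combinatorially_equivalent_tight).  For the polytope above, as for the
    cube, these are exactly the sets containing at most one inequality of each
    pair. *)

Set Implicit Arguments.
Unset Strict Implicit.
Unset Printing Implicit Defensive.

Import Order.TTheory GRing.Theory Num.Theory.
Import numFieldNormedType.Exports.

Local Open Scope classical_set_scope.
Local Open Scope ring_scope.

(** * Faces of polyhedra and tight inequalities *)

(** The ratio test: moving from slacks d in direction e, stop at the first
    positive slack that reaches 0. *)
Lemma first_vanishing_step (R : realFieldType) (J : finType) (d e : J -> R) :
  (forall j, 0 <= d j) -> (forall j, d j = 0 -> 0 <= e j) ->
  (exists j, e j < 0) ->
  exists eps, [/\ 0 < eps, (forall j, 0 <= d j + eps * e j) &
    exists j, d j != 0 /\ d j + eps * e j = 0].
Proof.
move=> d0 e0 [j0 ej0].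
case: (@arg_minP _ R J j0 (fun j => e j < 0) (fun j => d j / - e j)) => // i ei mini.
have di : d i != 0 by apply/eqP => /e0; rewrite leNgt ei.
exists (d i / - e i); split.
- by rewrite divr_gt0 ?oppr_gt0// lt_def di d0.
- move=> j; case: (ltP (e j) 0) => [ej|ej]; last first.
    by rewrite addr_ge0// mulr_ge0// divr_ge0// oppr_ge0 ltW.
  have := mini j ej; rewrite ler_pdivlMr ?oppr_gt0// mulrN.
  by rewrite addrC -subr_ge0 opprK addrC.
- exists i; split=> //; rewrite invrN mulrN mulNr divfK ?subrr//.
  by rewrite lt_eqF.
Qed.

Lemma small_step (R : realFieldType) (J : finType) (d e : J -> R) :
  (forall j, 0 <= d j) -> (forall j, d j = 0 -> 0 <= e j) ->
  exists2 eps, 0 < eps & forall j, 0 <= d j + eps * e j.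
Proof.
move=> d0 e0; case: (pselect (exists j, e j < 0)) => [ej|nej].
  by have [eps [? ? _]] := first_vanishing_step d0 e0 ej; exists eps.
exists 1 => // j; rewrite addr_ge0// mul1r leNgt; apply/negP => ej.
by apply: nej; exists j.
Qed.

Definition affine_set (R : realType) (V : lmodType R) (E : set V) : Prop :=
  forall x y r, E x -> E y -> E (x + r *: (y - x)).

Definition polyhedron (R : realType) (V : lmodType R) (J : finType)
    (E : set V) (a : J -> {scalar V}) (c : J -> R) : set V :=
  [set x | E x /\ forall j, c j <= a j x].

Definition tight (R : realType) (V : lmodType R) (J : finType)
    (a : J -> {scalar V}) (c : J -> R) (x : V) : {set J} :=
  [set j | a j x == c j]%SET.

(** The sign makes [sum_form a T] largest where the inequalities a_j >= c_j
    indexed by T are all tight, so that it exposes a face. *)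
Definition sum_form (R : realType) (V : lmodType R) (J : finType)
  (a : J -> {scalar V}) (T : {set J}) (x : V) : R := - \sum_(j in T) a j x.

Lemma sum_form_is_scalar (R : realType) (V : lmodType R) (J : finType)
  (a : J -> {scalar V}) (T : {set J}) : scalar (@sum_form R V J a T).
Proof.
move=> r x y; rewrite /sum_form mulrN -opprD mulr_sumr -big_split.
by congr (- _); apply: eq_bigr => j _ /=; rewrite linearD linearZ.
Qed.

HB.instance Definition _ (R : realType) (V : lmodType R) (J : finType)
  (a : J -> {scalar V}) (T : {set J}) :=
  GRing.isLinear.Build R V R _ (@sum_form R V J a T) (@sum_form_is_scalar R V J a T).

Section Faces.
Context (R : realType) (V : lmodType R) (J : finType).
Context (E : set V) (a : J -> {scalar V}) (c : J -> R).
Local Notation P := (polyhedron E a c).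
Local Notation tight := (tight a c).

Lemma tightP x j : reflect (a j x = c j) (j \in tight x).
Proof. by rewrite inE; exact: eqP. Qed.

Lemma tight_slack x j : P x -> j \notin tight x -> c j < a j x.
Proof. by move=> [_ /(_ j) h]; rewrite inE lt_def => ->. Qed.

(** If the inequalities tight at x are tight at y, the segment from y to x can be
    prolonged a little beyond x inside the polyhedron.  A linear form that is
    maximal at x, an inner point of this longer segment, is constant on it. *)
Lemma face_tight_closed F x y : affine_set E -> is_face P F ->
  F x -> P y -> (tight x \subset tight y)%SET -> F y.
Proof.
move=> affE [l [b [lb ->]]] [Px lx] Py /fintype.subsetP sxy; split=> //.
have [Ex cx] := Px; have [Ey cy] := Py.
have [j|j|eps eps0 H] :=
  @small_step R J (fun j => a j x - c j) (fun j => a j x - a j y).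
- by rewrite subr_ge0.
- move/eqP; rewrite subr_eq0 => ax; have /sxy : j \in tight x by rewrite inE.
  by rewrite inE => /eqP ->; move/eqP: ax => ->; rewrite subrr.
- have Pz : P (x + (- eps) *: (y - x)).
    split; first exact: affE.
    move=> j; rewrite linearD linearZ linearB/= -subr_ge0.
    by have := H j; rewrite mulNr -mulrN opprB addrAC.
  have := lb _ Pz; rewrite linearD linearZ linearB/= lx gerDl mulNr oppr_le0.
  rewrite pmulr_rge0// subr_ge0 => byx.
  by apply/eqP; rewrite eq_le byx lb.
Qed.

Lemma tight_face x : P x ->
  is_face P [set y | P y /\ (tight x \subset tight y)%SET].
Proof.
move=> Px; exists (sum_form a (tight x)), (- \sum_(j in tight x) c j).
split=> [y [_ cy]|]; first by rewrite /= lerN2 ler_sum.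
apply/seteqP; split => y [Py h]; split=> //.
  rewrite /= /sum_form; congr (- _); apply: eq_bigr => j /(fintype.subsetP h).
  by move=> /tightP.
move: h => /= /oppr_inj h; apply/fintype.subsetP => j jx; apply/tightP.
have [_ cy] := Py.
apply/eqP; rewrite eq_sym -subr_eq0; apply/eqP.
have : \sum_(i in tight x) (a i y - c i) == 0.
  by rewrite sumrB h subrr.
rewrite psumr_eq0; last by move=> i _; rewrite subr_ge0.
move=> /allP /(_ j); rewrite mem_index_enum jx /= => /(_ isT) /eqP e0.
by rewrite -opprB e0 oppr0.
Qed.

(** An inequality is tight at a midpoint only if it is tight at both ends. *)
Lemma midpoint_tight x y : affine_set E -> P x -> P y ->
  P (x + 2^-1 *: (y - x)) /\ tight (x + 2^-1 *: (y - x)) = (tight x :&: tight y)%SET.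
Proof.
move=> affE Px Py; have [Ex cx] := Px; have [Ey cy] := Py.
split; [split; first exact: affE|].
  by move=> j; rewrite linearD linearZ linearB/=; have := cx j; have := cy j; lra.
apply/setP => j; rewrite !inE linearD linearZ linearB/=.
have := cx j; have := cy j => h1 h2.
apply/eqP/andP => [h|[/eqP -> /eqP ->]]; last by lra.
by split; apply/eqP; lra.
Qed.

(** The point x0 is a point of F with the fewest tight inequalities: its midpoint
    with any other point of F has at least as many, so that all inequalities
    tight at x0 are tight on F. *)
Lemma face_tightE F x : affine_set E -> is_face P F -> F x ->
  exists2 x0, P x0 & F = [set y | P y /\ (tight x0 \subset tight y)%SET].
Proof.
move=> affE faceF Fx.
have FP z : F z -> P z by case: faceF => l [b [_ ->]] [].
pose Q (m : nat) := `[< exists2 z, F z & #|tight z| = m >].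
have exQ : exists m, Q m by exists #|tight x|; apply/asboolP; exists x.
case: (ex_minnP exQ) => m /asboolP [x0 Fx0 m0] minm.
exists x0; first exact: FP.
apply/seteqP; split => y.
  move=> Fy; split; first exact: FP.
  have [Pz tz] := midpoint_tight affE (FP _ Fx0) (FP _ Fy).
  have Fz : F (x0 + 2^-1 *: (y - x0)).
    case: faceF => l [b [lb FE]]; rewrite FE; split=> //.
    move: Fx0 Fy; rewrite FE => -[_ h0] [_ h1].
    by rewrite linearD linearZ linearB/= h0 h1 subrr mulr0 addr0.
  have : (m <= #|tight (x0 + 2^-1 *: (y - x0))|)%N.
    by apply: minm; apply/asboolP; exists (x0 + 2^-1 *: (y - x0)).
  rewrite tz -m0 => le; apply/finset.setIidPl/eqP.
  by rewrite eqEcard finset.subsetIl.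
by move=> [Py s]; exact: face_tight_closed Fx0 Py s.
Qed.

End Faces.

Lemma face0 (R : realType) (V : lmodType R) (P : set V) : is_face P set0.
Proof.
exists (\0 : {scalar V}), 1; split=> [x _|]; first exact: ler01.
apply/seteqP; split=> // x [_] /= /eqP; rewrite eq_sym oner_eq0//.
Qed.

(** Quantifying over the points of F, instead of taking their common equalities,
    makes this obviously monotone in F and sends the empty face to itself. *)
Definition transfer (R : realType) (V W : lmodType R) (J : finType)
    (E : set V) (a : J -> {scalar V}) (c : J -> R)
    (E' : set W) (a' : J -> {scalar W}) (c' : J -> R) (F : set V) : set W :=
  [set y | polyhedron E' a' c' y /\
    exists2 x, F x & (tight a c x \subset tight a' c' y)%SET].

Section Transfer.
Context (R : realType) (V W : lmodType R) (J : finType).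
Context (E : set V) (a : J -> {scalar V}) (c : J -> R).
Context (E' : set W) (a' : J -> {scalar W}) (c' : J -> R).
Local Notation P := (polyhedron E a c).
Local Notation P' := (polyhedron E' a' c').

Hypothesis pattern_sub : forall x, P x ->
  exists2 y, P' y & tight a' c' y = tight a c x.

Lemma transfer_face F : affine_set E -> is_face P F ->
  is_face P' (transfer E a c E' a' c' F).
Proof.
move=> affE faceF.
case: (pselect (exists x, F x)) => [[x Fx]|F0]; last first.
  rewrite (_ : transfer _ _ _ _ _ _ F = set0); first exact: face0.
  by apply/seteqP; split => // y [_ [x Fx _]]; apply: F0; exists x.
have [x0 Px0 FE] := face_tightE affE faceF Fx.
have [y0 P'y0 ty0] := pattern_sub Px0.
rewrite (_ : transfer _ _ _ _ _ _ F =
  [set y | P' y /\ (tight a' c' y0 \subset tight a' c' y)%SET]).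
  exact: tight_face.
apply/seteqP; split => y [P'y].
  move=> [x1]; rewrite FE => -[Px1 s01] s1y; split=> //.
  by rewrite ty0; exact: fintype.subset_trans s01 s1y.
move=> s; split=> //; exists x0; last by rewrite -ty0.
by rewrite FE.
Qed.

Lemma transferK F : affine_set E -> is_face P F ->
  transfer E' a' c' E a c (transfer E a c E' a' c' F) = F.
Proof.
move=> affE faceF; have FP z : F z -> P z by case: faceF => l [b [_ ->]] [].
apply/seteqP; split => x.
  move=> [Px [y [P'y [x1 Fx1 s1]] s2]].
  apply: (face_tight_closed affE faceF Fx1 Px).
  exact: fintype.subset_trans s1 s2.
move=> Fx; have Px := FP _ Fx; split=> //; have [y P'y ty] := pattern_sub Px.
exists y; last by rewrite ty.
by split=> //; exists x => //; rewrite ty.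
Qed.

End Transfer.

(** The face lattice is encoded in the tight patterns: nonempty faces correspond
    to the sets of inequalities tight at some point, in reverse order. *)
Lemma combinatorially_equivalent_tight (R : realType) (V W : lmodType R)
    (J : finType) (E : set V) (a : J -> {scalar V}) (c : J -> R)
    (E' : set W) (a' : J -> {scalar W}) (c' : J -> R) :
  affine_set E -> affine_set E' ->
  (forall x, polyhedron E a c x ->
    exists2 y, polyhedron E' a' c' y & tight a' c' y = tight a c x) ->
  (forall y, polyhedron E' a' c' y ->
    exists2 x, polyhedron E a c x & tight a c x = tight a' c' y) ->
  combinatorially_equivalent (polyhedron E a c) (polyhedron E' a' c').
Proof.
move=> affE affE' sub sub'.
have mono (U U' : lmodType R) (D : set U) b d (D' : set U') b' d' F G :
    F `<=` G -> @transfer R U U' J D b d D' b' d' F `<=` transfer D b d D' b' d' G.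
  by move=> FG y [Py [x Fx s]]; split=> //; exists x => //; exact: FG.
exists (transfer E a c E' a' c'); split; [split|] => [F|F G|F|F G] /=.
- exact: transfer_face.
- rewrite !inE => fF fG eq.
  by rewrite -(transferK sub affE fF) eq transferK.
- move=> fF; exists (transfer E' a' c' E a c F).
    exact: transfer_face.
  exact: transferK.
- move=> fF fG; split; first exact: mono.
  by move=> /(@mono _ _ E' a' c' E a c); rewrite !transferK.
Qed.

(** A polyhedron lies in the convex set C once this is known for the points that
    cannot be moved in both directions without loosening a tight inequality.
    Moving any other point both ways until further inequalities become tight
    exhibits it as a convex combination of two points with more of them. *)
Lemma polyhedron_sub_convex (R : realType) (V : lmodType R) (J : finType)
    (E : set V) (a : J -> {scalar V}) (c : J -> R) (C : set V) :
  (forall x y r, C x -> C y -> 0 <= r <= 1 -> C (x + r *: (y - x))) ->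
  (forall x, polyhedron E a c x -> C x \/
    exists v, [/\ forall r, E (x + r *: v),
      forall j, j \in tight a c x -> a j v = 0,
      exists j, a j v < 0 & exists j, 0 < a j v]) ->
  polyhedron E a c `<=` C.
Proof.
move=> convC H x.
have [m] := ubnP #|~: tight a c x|%SET; elim: m x => // m IH x ltm Px.
have [//|[v [Ev tv neg pos]]] := H x Px; have [Ex cx] := Px.
have step w : (forall r, E (x + r *: w)) ->
    (forall j, j \in tight a c x -> a j w = 0) -> (exists j, a j w < 0) ->
    exists2 s, 0 < s & C (x + s *: w).
  move=> Ew tw negw.
  have [j|j|//|s [s0 h [j [d0 dj]]]] :=
    @first_vanishing_step R J (fun j => a j x - c j) (fun j => a j w).
  - by rewrite subr_ge0.
  - by move/eqP; rewrite subr_eq0 => ax; rewrite tw// inE.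
  - exists s => //; apply: IH.
      move: ltm; rewrite ltnS; apply: ssrnat.leq_trans; rewrite proper_card//.
      rewrite properC; apply/properP; split.
        apply/fintype.subsetP => i ix; apply/tightP; rewrite linearD linearZ/=.
        by rewrite (tw i ix) mulr0 addr0; exact/tightP.
      exists j; last by rewrite inE -subr_eq0.
      apply/tightP; rewrite linearD linearZ/=.
      by apply/eqP; rewrite -subr_eq0 addrAC dj.
    split; first exact: Ew.
    by move=> i; rewrite linearD linearZ/= -subr_ge0 addrAC.
have [s s0 Cs] := step v Ev tv neg.
have [r|j /tv vj|//|u u0 Cu] := step (- v).
- by rewrite scalerN -scaleNr.
- by rewrite linearN/= vj oppr0.
- by case: pos => j; exists j; rewrite linearN oppr_lt0.
have su0 : 0 < s + u by rewrite addr_gt0.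
have r01 : 0 <= s / (s + u) <= 1.
  by apply/andP; split; [apply: divr_ge0; exact: ltW|
    rewrite ler_pdivrMr// mul1r lerDl ltW].
(* x divides the segment from x + s v to x - u v in the ratio s : u. *)
have := convC _ _ (s / (s + u)) Cs Cu r01.
congr (C _); rewrite opprD addrACA subrr add0r scalerN -opprD -scalerDl.
rewrite scalerN scalerA [u + s]addrC divfK ?gt_eqF// addrK//.
Qed.

(** * Triangulations of a segment and the secondary polytope *)

Lemma convex_hull_sub (R : realType) (V : lmodType R) (X : set V) :
  X `<=` convex_hull X.
Proof. exact: sub_smallest. Qed.

Lemma convex_hull_conv (R : realType) (V : lmodType R) (X : set V) x y r :
  convex_hull X x -> convex_hull X y -> 0 <= r <= 1 ->
  convex_hull X (x + r *: (y - x)).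
Proof.
move=> Xx Xy /andP[r0 r1] C [convC XC].
have Cx : x \in (C : set (convex_lmodType V)) by rewrite inE; apply: Xx.
have Cy : y \in (C : set (convex_lmodType V)) by rewrite inE; apply: Xy.
have -> : x + r *: (y - x) = r *: y + (1 - r) *: x.
  by rewrite scalerBl scale1r scalerBr addrCA.
by have := convC y x (Itv01 r0 r1) Cy Cx; rewrite inE.
Qed.

Lemma convex_hull_ge (R : realType) (V : lmodType R) (X : set V)
    (l : {scalar V}) (b : R) :
  (forall x, X x -> b <= l x) -> forall x, convex_hull X x -> b <= l x.
Proof.
move=> Xb x Xx; apply: (Xx [set y | b <= l y]); split=> // y z r; rewrite !inE /= => by_ bz.
change (b <= l ((r%:inum) *: (y : V) + (1 - r%:inum) *: (z : V))).
rewrite linearD !linearZ/=.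
have r0 : 0 <= r%:inum by [].
have r1 : r%:inum <= 1 by [].
nra.
Qed.

Definition wform (R : realType) (m : nat) (w : 'I_m -> R) (x : 'rV[R]_m) : R :=
  \sum_i w i * x 0 i.

Lemma wform_is_scalar (R : realType) (m : nat) (w : 'I_m -> R) : scalar (wform w).
Proof.
move=> r x y; rewrite /wform mulr_sumr -big_split; apply: eq_bigr => i _ /=.
by rewrite !mxE mulrDr mulrCA.
Qed.

HB.instance Definition _ (R : realType) (m : nat) (w : 'I_m -> R) :=
  GRing.isLinear.Build R 'rV[R]_m R _ (wform w) (wform_is_scalar w).

(** Subtraction of natural numbers is truncated, so the weight of x_i is the
    positive part of j - i. *)
Definition height (R : realType) (m j : nat) : {scalar 'rV[R]_m} :=
  wform (fun i : 'I_m => (j - i)%N%:R).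
Arguments height R {m} j.

Definition coord_sum (R : realType) (m : nat) : {scalar 'rV[R]_m} :=
  wform (fun _ : 'I_m => 1).
Arguments coord_sum R {m}.

Section Triangulation.
Context (R : realType) (n : nat).
Implicit Types (T : {set 'I_n.+2 * 'I_n.+2}).

(** Test the middle of the cell: it is not an integer, so it is not in the
    intersection of two distinct segments. *)
Lemma unit_cell_cover T (c : nat) : is_triangulation R T -> (c < n.+1)%N ->
  exists2 s, s \in T & forall t, t \in T -> (t.1 <= c < t.2)%N = (t == s).
Proof.
move=> [ltT covT intT] cn.
pose r : R := c%:R + 2^-1.
have natr_lt (a : nat) : (a%:R <= r) = (a <= c)%N.
  apply/idP/idP => [h|h].
    by rewrite -ltnS -(ltr_nat R) -natr1; rewrite /r in h; lra.
  by move: h; rewrite -(ler_nat R) /r; lra.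
have natr_gt (a : nat) : (r <= a%:R) = (c < a)%N.
  apply/idP/idP => [h|h].
    by rewrite -(ltr_nat R); rewrite /r in h; lra.
  by move: h; rewrite -(ler_nat R) -natr1 /r; lra.
have segE s : segment R s r <-> (s.1 <= c < s.2)%N.
  by rewrite /segment/= in_itv/= natr_lt natr_gt.
have : (`[0, n.+1%:R]%classic : set R) r.
  by rewrite /= in_itv/= natr_gt cn andbT; have := natr_lt 0; rewrite leq0n.
rewrite -covT => -[s /= sT /segE sc]; exists s => // t tT.
apply/idP/eqP => [tc|->//]; apply/eqP/negPn/negP => ts.
have : (segment R t `&` segment R s) r by split; exact/segE.
rewrite intT// => -[a _ ar].
by have := natr_lt a; have := natr_gt a; rewrite -ar !lexx; lia.
Qed.

(** Cut each segment into unit cells: every cell of [0, N] is used once. *)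
Lemma triangulation_telescope T (G : nat -> R) : is_triangulation R T ->
  \sum_(s in T) (G s.2 - G s.1) = G n.+1 - G 0.
Proof.
move=> triT; have [ltT _ _] := triT.
transitivity (\sum_(s in T) \sum_(0 <= c < n.+1 | (s.1 <= c < s.2)%N) (G c.+1 - G c)).
  apply: eq_bigr => s sT; rewrite -telescope_sumr; last exact/ltnW/ltT.
  rewrite (@big_cat_nat _ _ _ s.1 0 n.+1)//=; last exact: leq_ord.
  rewrite [X in X + _]big1_seq ?add0r; last first.
    by move=> c; rewrite mem_index_iota; lia.
  rewrite (@big_cat_nat _ _ _ s.2 s.1 n.+1)//=; last 2 first.
    exact/ltnW/ltT.
    exact: leq_ord.
  rewrite [X in _ = _ + X]big1_seq ?addr0; last first.
    by move=> c; rewrite mem_index_iota; lia.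
  rewrite [RHS]big_mkcond/=; apply: eq_big_nat => c ->//.
rewrite -telescope_sumr// (exchange_big_dep xpredT)//=.
apply: eq_big_nat => c /andP[_ cn].
have [s sT sE] := unit_cell_cover triT cn.
rewrite (bigD1 s)/=; last by rewrite sT sE ?eqxx.
rewrite big1 ?addr0// => t /andP[/andP[tT]].
by rewrite sE// => ->.
Qed.

Lemma wform_gkz T (w : 'I_n.+2 -> R) : (forall s, s \in T -> (s.1 < s.2)%N) ->
  wform w (gkz_vector R T) = \sum_(s in T) seg_length R s * (w s.1 + w s.2).
Proof.
move=> ltT; rewrite /wform.
under eq_bigr do rewrite mxE mulr_sumr.
rewrite (exchange_big_dep (mem T))/=; last by move=> i s _ /andP[].
apply: eq_bigr => s sT.
have s21 : s.2 != s.1 by apply/eqP => h; have := ltT _ sT; rewrite h ltnn.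
rewrite (bigD1 s.1)/=; last by rewrite sT !inE eqxx.
rewrite (bigD1 s.2)/=; last by rewrite sT !inE eqxx orbT.
rewrite big1 ?addr0; first by rewrite -mulrDl mulrC.
by move=> i; rewrite !inE => /andP[/andP[/andP[_ /orP[]/eqP ->]]]; rewrite eqxx.
Qed.

(** With A and B the positive parts of j - a and j - b, this is
    A^2 - B^2 <= (b - a) (A + B), which holds because A - B <= b - a, with
    equality unless j lies strictly between a and b.  Summed over a triangulation
    the left-hand sides telescope to j^2. *)
Lemma height_gkz_term (j a b : nat) : (a < b)%N ->
  (j - a)%N%:R ^+ 2 - (j - b)%N%:R ^+ 2 <= (b%:R - a%:R) * ((j - a)%N%:R + (j - b)%N%:R) :> R.
Proof.
move=> ab; have := ab; rewrite -(ltr_nat R) => abR.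
have [ja|aj] := leqP j a.
  have -> : (j - a)%N = 0%N by lia.
  have -> : (j - b)%N = 0%N by lia.
  by lra.
have [bj|jb] := leqP b j; first by rewrite !natrB//; [lra|lia].
rewrite (_ : (j - b)%N = 0%N); last lia.
rewrite natrB; last lia.
by move: aj jb; rewrite -!(ltr_nat R); nra.
Qed.

Lemma height_gkz_term_eq (j a b : nat) : (a < b)%N -> ~~ (a < j < b)%N ->
  (j - a)%N%:R ^+ 2 - (j - b)%N%:R ^+ 2 = (b%:R - a%:R) * ((j - a)%N%:R + (j - b)%N%:R) :> R.
Proof.
move=> ab.
have [ja|aj] := leqP j a => /= jb.
  have -> : (j - a)%N = 0%N by lia.
  have -> : (j - b)%N = 0%N by lia.
  by ring.
by rewrite !natrB//; [ring|lia|lia].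
Qed.

Let height_sq T j : is_triangulation R T -> (j <= n.+1)%N ->
  \sum_(s in T) ((j - s.1)%N%:R ^+ 2 - (j - s.2)%N%:R ^+ 2) = j%:R ^+ 2 :> R.
Proof.
move=> triT jn.
have := triangulation_telescope (fun c => - ((j - c)%N%:R ^+ 2)) triT.
rewrite (_ : (j - n.+1)%N = 0%N) ?subn0; last lia.
rewrite expr0n/= oppr0 add0r opprK => <-.
by apply: eq_bigr => s _; rewrite opprK addrC.
Qed.

Lemma height_gkz_ge T j : is_triangulation R T -> (j <= n.+1)%N ->
  j%:R ^+ 2 <= height R j (gkz_vector R T).
Proof.
move=> triT jn; have [ltT _ _] := triT.
rewrite /height /coord_sum /= wform_gkz// -(height_sq triT jn); apply: ler_sum => s sT.
exact/height_gkz_term/ltT.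
Qed.

Lemma height_gkz_eq T j : is_triangulation R T -> (j <= n.+1)%N ->
  (forall s, s \in T -> ~~ (s.1 < j < s.2)%N) ->
  height R j (gkz_vector R T) = j%:R ^+ 2.
Proof.
move=> triT jn jT; have [ltT _ _] := triT.
rewrite /height /coord_sum /= wform_gkz// -(height_sq triT jn); apply: eq_bigr => s sT.
by rewrite -height_gkz_term_eq//; [exact: ltT|exact: jT].
Qed.

Lemma coord_sum_gkz T : is_triangulation R T ->
  coord_sum R (gkz_vector R T) = (n.+1)%:R *+ 2.
Proof.
move=> triT; have [ltT _ _] := triT.
rewrite /height /coord_sum /= wform_gkz//.
have /= := triangulation_telescope (fun c => c%:R) triT.
rewrite subr0 => <-; rewrite -sumrMnl; apply: eq_bigr => s sT.
by rewrite mulrDr mulr1 mulr2n.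
Qed.

Lemma gkz_ge0 T i : is_triangulation R T -> 0 <= gkz_vector R T 0 i.
Proof.
move=> [ltT _ _]; rewrite mxE sumr_ge0// => s /andP[sT _].
by rewrite subr_ge0 ler_nat ltnW ?ltT.
Qed.

Local Notation P := (secondary_polytope R n).

Lemma secondary_ge (l : {scalar 'rV[R]_n.+2}) b :
  (forall T, is_triangulation R T -> b <= l (gkz_vector R T)) ->
  forall x, P x -> b <= l x.
Proof. by move=> H; apply: convex_hull_ge => _ [T triT <-]; exact: H. Qed.

Lemma secondary_eq (l : {scalar 'rV[R]_n.+2}) b :
  (forall T, is_triangulation R T -> l (gkz_vector R T) = b) ->
  forall x, P x -> l x = b.
Proof.
move=> H x Px; apply/eqP; rewrite eq_le; apply/andP; split; last first.
  by apply: secondary_ge Px => T triT; rewrite H.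
rewrite -lerN2.
by apply: (@secondary_ge (\- l) (- b)) Px => T triT; rewrite /= H.
Qed.

Lemma secondary_ge0 x i : P x -> 0 <= x 0 i.
Proof. by apply: (@secondary_ge (coord_form i)) => T triT; exact: gkz_ge0. Qed.

Lemma secondary_coord_sum x : P x -> coord_sum R x = (n.+1)%:R *+ 2.
Proof. by apply: secondary_eq => T; exact: coord_sum_gkz. Qed.

Lemma secondary_height_ge x j : (j <= n.+1)%N -> P x -> j%:R ^+ 2 <= height R j x.
Proof. by move=> jn; apply: secondary_ge => T triT; exact: height_gkz_ge. Qed.

Lemma secondary_height_last x : P x -> height R n.+1 x = (n.+1)%:R ^+ 2.
Proof.
apply: secondary_eq => T triT; apply: height_gkz_eq => // s sT.
by rewrite negb_and -!leqNgt leq_ord orbT.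
Qed.

Lemma height_ge_linear (x : 'rV[R]_n.+2) j : (forall i, 0 <= x 0 i) ->
  j%:R * x 0 ord0 <= height R j x.
Proof.
move=> x0; rewrite /height /= /wform (bigD1 ord0)//= subn0 lerDl.
by rewrite sumr_ge0// => i _; rewrite mulr_ge0.
Qed.

Lemma height_eq_linear (x : 'rV[R]_n.+2) j :
  (forall i : 'I_n.+2, (0 < i < j)%N -> x 0 i = 0) ->
  height R j x = j%:R * x 0 ord0.
Proof.
move=> x0; rewrite /height /= /wform (bigD1 ord0)//= subn0 big1 ?addr0// => i i0.
have [ij|ji] := ltnP i j; last by rewrite (_ : (j - i)%N = 0%N) ?mul0r//; lia.
by rewrite x0 ?mulr0// ij andbT lt0n.
Qed.

Definition gaps (S : {set 'I_n.+2}) : {set 'I_n.+2 * 'I_n.+2} :=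
  [set s | [&& s.1 \in S, s.2 \in S, (s.1 < s.2)%N &
     [forall c in S, ~~ (s.1 < c < s.2)%N]]]%SET.

Lemma gapsP (S : {set 'I_n.+2}) s :
  reflect [/\ s.1 \in S, s.2 \in S, (s.1 < s.2)%N &
    forall c, c \in S -> ~~ (s.1 < c < s.2)%N] (s \in gaps S).
Proof.
rewrite inE; apply: (iffP and4P) => -[h1 h2 h3 h4]; split=> //.
  by move=> c cS; have /forall_inP/(_ c cS) := h4.
exact/forall_inP.
Qed.

Lemma gaps_ordered (S : {set 'I_n.+2}) s t :
  s \in gaps S -> t \in gaps S -> s != t -> (s.2 <= t.1)%N || (t.2 <= s.1)%N.
Proof.
case: s t => [s1 s2] [t1 t2] /gapsP/= [Ss1 Ss2 s12 sS] /gapsP/= [St1 St2 t12 tS] st.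
have := sS _ St1; have := sS _ St2; have := tS _ Ss1; have := tS _ Ss2 => h1 h2 h3 h4.
apply: contraR st => h; apply/eqP.
suff [e1 e2] : s1 = t1 :> nat /\ s2 = t2 :> nat by rewrite (val_inj e1) (val_inj e2).
by split; lia.
Qed.

Lemma vert_segment (s : 'I_n.+2 * 'I_n.+2) a : (s.1 < s.2)%N -> a \in vert s ->
  segment R s (a : nat)%:R.
Proof.
by move=> s12; rewrite !inE /segment/= in_itv/= => /orP[]/eqP ->; rewrite !ler_nat; lia.
Qed.

Lemma last_before (S : {set 'I_n.+2}) (Q : pred nat) : ord0 \in S -> Q 0%N ->
  exists a : 'I_n.+2, [/\ a \in S, Q a & forall b : 'I_n.+2, b \in S -> Q b -> (b <= a)%N].
Proof.
move=> S0 Q0.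
case: (@arg_maxnP _ ord0 (fun i : 'I_n.+2 => (i \in S) && Q i) (fun i => i : nat)) => /=.
  by rewrite S0.
by move=> a /andP[aS Qa] h; exists a; split=> // b bS Qb; apply: h; rewrite bS.
Qed.

Lemma first_after (S : {set 'I_n.+2}) (Q : pred nat) : ord_max \in S -> Q n.+1 ->
  exists a : 'I_n.+2, [/\ a \in S, Q a & forall b : 'I_n.+2, b \in S -> Q b -> (a <= b)%N].
Proof.
move=> S0 Q0.
case: (@arg_minnP _ (@ord_max n.+1) (fun i : 'I_n.+2 => (i \in S) && Q i) (fun i => i : nat)) => /=.
  by rewrite S0.
by move=> a /andP[aS Qa] h; exists a; split=> // b bS Qb; apply: h; rewrite bS.
Qed.

Lemma gaps_triangulation (S : {set 'I_n.+2}) : ord0 \in S -> ord_max \in S ->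
  is_triangulation R (gaps S).
Proof.
move=> S0 Sm; split.
- by move=> s /gapsP[].
- apply/seteqP; split=> [r [s /= sT]|r].
    rewrite /segment/= !in_itv/= => /andP[h1 h2]; apply/andP; split.
      by apply: le_trans h1.
    by apply: le_trans h2 _; rewrite ler_nat -ltnS.
  rewrite /= in_itv/= => /andP[r0 rn].
  (* The condition c < N keeps room for a right end when r = N. *)
  have [|a [aS /andP[an ar] amax]] := @last_before S (fun c => (c < n.+1)%N && (c%:R <= r)) S0.
    by rewrite r0.
  have [b [bS ab bmin]] := @first_after S (fun c => (a < c)%N) Sm an.
  exists (a, b) => /=.
    apply/gapsP; split=> //= c cS; apply/negP => /andP[ac].
    by rewrite ltnNge bmin.
  rewrite /segment/= in_itv/= ar/= leNgt; apply/negP => br.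
  have bn : (b < n.+1)%N by rewrite -(ltr_nat R) (lt_le_trans br).
  by have := amax b bS; rewrite bn (ltW br) => /(_ isT); lia.
- move=> s t sT tT st.
  have [_ _ s12 _] := gapsP _ _ sT; have [_ _ t12 _] := gapsP _ _ tT.
  apply/seteqP; split=> [r|r [a]]; last first.
    by rewrite /= inE => /andP[avs avt] <-; split; exact: vert_segment.
  rewrite /segment/= => -[]; rewrite !in_itv/= => /andP[h1 h2] /andP[h3 h4].
  have /orP[le|le] := gaps_ordered sT tT st; have := le; rewrite -(ler_nat R) => leR.
    have E : s.2 = t.1 by apply/val_inj/eqP; rewrite -(eqr_nat R) eq_le; lra.
    exists s.2; first by rewrite /= !inE E !eqxx orbT.
    by apply/eqP; rewrite eq_le; lra.
  have E : t.2 = s.1 by apply/val_inj/eqP; rewrite -(eqr_nat R) eq_le; lra.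
  exists t.2; first by rewrite /= !inE E !eqxx orbT.
  by apply/eqP; rewrite eq_le; lra.
Qed.

End Triangulation.

(** * Monotone paths on the secondary polytope *)

Section Path.
Context (R : realType) (n : nat).
Implicit Types (K S : {set 'I_n.+2}).
Local Notation P := (secondary_polytope R n).

(** The vertex set of the triangulation which the path through K reaches at
    slope a. *)
Definition vertices_from K (a : nat) : {set 'I_n.+2} := (ord0 |: [set k in K | (a <= k)%N])%SET.

(** The conditions determine the point at which the monotone path that starts at
    the triangulation K, and removes its first interior vertex again and again,
    takes the value t. *)
Definition on_path K (t : R) (x : 'rV[R]_n.+2) : Prop :=
  [/\ P x, x 0 ord0 = t, (forall i, i \notin K -> x 0 i = 0) &
   forall k : 'I_n.+2, k \in K -> (0 < k)%N -> height R k x = k%:R * Num.max t k%:R].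

Lemma gkz_supp S i : i \notin S -> gkz_vector R (gaps S) 0 i = 0.
Proof.
move=> iS; rewrite mxE big1// => s /andP[/gapsP[s1 s2 _ _]].
by rewrite !inE => /orP[]/eqP e; move: iS; rewrite e ?s1 ?s2.
Qed.

(** For k < a no vertex lies between 0 and k, so the height is linear there; its
    slope is a because the height at a is a^2. *)
Lemma on_path_vertex K (a : 'I_n.+2) : ord0 \in K -> ord_max \in K ->
  a \in K -> (0 < a)%N -> on_path K a%:R (gkz_vector R (gaps (vertices_from K a))).
Proof.
move=> K0 Km aK a0; set S := vertices_from K a; set x := gkz_vector R _.
have Sm : ord_max \in S by rewrite !inE Km leq_ord orbT.
have S0 : ord0 \in S by rewrite !inE eqxx.
have triS := gaps_triangulation R S0 Sm.
have sq (k : 'I_n.+2) : k \in K -> (a <= k)%N -> height R k x = k%:R ^+ 2.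
  move=> kK ak; apply: height_gkz_eq => //; first exact: leq_ord.
  by move=> s /gapsP[_ _ _]; apply; rewrite !inE kK ak orbT.
have lin (k : 'I_n.+2) : (k <= a)%N -> height R k x = k%:R * x 0 ord0.
  move=> ka; apply: height_eq_linear => i /andP[i0 ik]; apply: gkz_supp.
  rewrite !inE negb_or -val_eqE/= -lt0n i0/= negb_and -ltnNge.
  by rewrite (leq_trans ik ka) orbT.
have x0 : x 0 ord0 = a%:R.
  have := sq a aK (leqnn a); rewrite lin// expr2 => /mulfI; apply.
  by rewrite pnatr_eq0 -lt0n.
split=> //.
- by apply: convex_hull_sub; exists (gaps S).
- move=> i iK; apply: gkz_supp; rewrite !inE negb_or (negbTE iK) andbT.
  by apply: contra iK => /eqP ->.
- move=> k kK k0; have [ak|ka] := leqP a k.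
    by rewrite sq// expr2 max_r ?ler_nat.
  by rewrite lin; [rewrite x0 max_l// ler_nat; exact: ltnW|exact: ltnW].
Qed.

(** On an interval [a, b] meeting K at most in its ends, t |-> max t k is affine
    for every k in K. *)
Lemma on_path_conv K (a b : nat) x y (r t : R) :
  on_path K a%:R x -> on_path K b%:R y -> 0 <= r <= 1 ->
  t = a%:R + r * (b%:R - a%:R) ->
  (forall k : 'I_n.+2, k \in K -> (k <= a)%N || (b <= k)%N) -> (a <= b)%N ->
  on_path K t (x + r *: (y - x)).
Proof.
move=> [Px x0 xK xh] [Py y0 yK yh] r01 tE Kab ab; split.
- exact: convex_hull_conv.
- by rewrite !mxE x0 y0.
- by move=> i iK; rewrite !mxE xK// yK// subrr mulr0 addr0.
- move=> k kK k0; rewrite linearD linearZ linearB/= xh// yh// tE.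
  move: ab; rewrite -(ler_nat R) => ab; move/andP: r01 => [r0 r1].
  have /orP[] := Kab k kK; rewrite -(ler_nat R) => h; last first.
    rewrite !max_r//; [ring| |lra].
    nra.
  rewrite !max_l//; [ring| |lra].
  nra.
Qed.

Lemma on_path_nat K (c : nat) : ord0 \in K -> ord_max \in K ->
  (forall i : 'I_n.+2, i = 1%N :> nat -> i \in K) ->
  (0 < c)%N -> (c <= n.+1)%N -> exists x, on_path K c%:R x.
Proof.
move=> K0 Km K1 c0 cn.
(* a and b are the elements of K around c, both equal to c if c is in K. *)
have [a [aK ac amax]] := @last_before n K (fun i => (i <= c)%N) K0 isT.
have [b [bK cb bmin]] := @first_after n K (fun i => (c <= i)%N) Km cn.
have a0 : (0 < a)%N.
  have n1 : (1 < n.+2)%N by [].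
  by have := amax (Ordinal n1) (K1 (Ordinal n1) erefl) c0.
have b0 : (0 < b)%N by exact: leq_trans c0 cb.
have ab : (a <= b)%N by exact: leq_trans ac cb.
have xa := on_path_vertex K0 Km aK a0.
have [E|ne] := eqVneq (a : nat) b.
  rewrite (_ : c = a); last by apply/eqP; rewrite eqn_leq ac {1}E cb.
  by eexists; exact: xa.
have ltab : (a < b)%N by rewrite ltn_neqAle ne.
have d0 : 0 < b%:R - a%:R :> R by rewrite subr_gt0 ltr_nat.
eexists; apply: (on_path_conv (r := (c%:R - a%:R) / (b%:R - a%:R)) xa
  (on_path_vertex K0 Km bK b0)) => //.
- rewrite divr_ge0 ?(ltW d0) ?subr_ge0 ?ler_nat//=.
  by rewrite ler_pdivrMr// mul1r lerD2r ler_nat.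
- by rewrite divfK ?gt_eqF// addrC subrK.
- move=> k kK; have [kc|ck] := leqP k c; first by rewrite amax.
  by rewrite (bmin k) ?orbT// ltnW.
Qed.

(** Interpolating at the integers instead of at K covers all paths by one formula,
    whose continuity gives measurability. *)
Definition hat (c : nat) (t : R) : R := Num.max 0 (1 - `|t - c%:R|).

Lemma unit_cell (t : R) : 1 <= t <= n.+1%:R -> (0 < n)%N ->
  exists a b : 'I_n.+2, [/\ (0 < a)%N, b = a.+1 :> nat & a%:R <= t <= b%:R].
Proof.
move=> /andP[t1 tn] n0.
have t0 : 0 <= t by lra.
have [|a [_ /andP[an ta] amax]] :=
  @last_before n [set: 'I_n.+2]%SET (fun c => (c < n.+1)%N && (c%:R <= t)) (finset.in_setT _).
  by rewrite t0.
have a1 : (a.+1 < n.+2)%N by [].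
exists a, (Ordinal a1); split=> //; last first.
  rewrite ta/= leNgt; apply/negP => lt.
  have an' : (a.+1 < n.+1)%N by rewrite -(ltr_nat R) (lt_le_trans lt).
  have := amax (Ordinal a1) (finset.in_setT _); rewrite an' (ltW lt) /= => /(_ isT).
  by rewrite ltnn.
have n1 : (1 < n.+2)%N by [].
by have := amax (Ordinal n1) (finset.in_setT _); rewrite /= t1 ltnS n0 => /(_ isT).
Qed.

Lemma hat_interpolation (p : 'I_n.+2 -> 'rV[R]_n.+2) (a b : 'I_n.+2) (t : R) :
  b = a.+1 :> nat -> a%:R <= t <= b%:R ->
  \sum_(c < n.+2) hat c t *: p c = p a + (t - a%:R) *: (p b - p a).
Proof.
move=> ba; have baR : b%:R = a%:R + 1 :> R by rewrite ba natr1.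
rewrite baR => /andP[ta tb].
have ab : b != a by rewrite -val_eqE/= ba; lia.
rewrite (bigD1 a)//= (bigD1 b)//= big1 ?addr0.
  rewrite {1 2}/hat baR ger0_norm ?subr_ge0// ler0_norm; last by lra.
  rewrite !max_r; [|lra|lra].
  rewrite [LHS](_ : _ = (1 - (t - a%:R)) *: p a + (t - a%:R) *: p b); last first.
    by congr (_ + _ *: _); ring.
  by rewrite scalerBl scale1r scalerBr addrAC addrA.
move=> c /andP[ca cb]; rewrite /hat max_l ?scale0r// subr_le0.
have [h|h] := leqP c a.
  have h' : (c < a)%N by rewrite ltn_neqAle h andbT.
  move: h'; rewrite -(ler_nat R) -natr1 => h'.
  by rewrite ger0_norm; lra.
have h' : (b < c)%N by rewrite ltn_neqAle ba h andbT -ba eq_sym.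
move: h'; rewrite -(ler_nat R) -natr1 baR => h'.
by rewrite ler0_norm; lra.
Qed.

Lemma path_section K : (0 < n)%N -> ord0 \in K -> ord_max \in K ->
  (forall i : 'I_n.+2, i = 1%N :> nat -> i \in K) ->
  exists s : R -> 'rV[R]_n.+2,
    (forall i, measurable_fun setT (fun t => s t 0 i)) /\
    (forall t, 1 <= t <= n.+1%:R -> on_path K t (s t)).
Proof.
move=> n0 K0 Km K1.
have /choice[p pP] : forall c : 'I_n.+2,
    exists x, (0 < c)%N -> on_path K c%:R x.
  move=> c; have [c0|c0] := posnP c; first by exists 0; rewrite c0.
  by have [x xP] := on_path_nat K0 Km K1 c0 (leq_ord c); exists x.
exists (fun t => \sum_(c < n.+2) hat c t *: p c); split=> [i|t t1n].
  apply: (eq_measurable_fun (fun t => \sum_(c < n.+2) hat c t * p c 0 i)).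
    by move=> t _; rewrite summxE; apply: eq_bigr => c _; rewrite mxE.
  apply: measurable_sum => c; apply: measurable_funM => //.
  apply: measurable_maxr => //; apply: measurable_funB => //.
  by apply: measurableT_comp => //; apply: measurable_funB.
have [a [b [a0 ba tab]]] := unit_cell t1n n0.
rewrite (hat_interpolation _ ba)//.
have [ta tb] := andP tab.
apply: (on_path_conv (pP a a0) (pP b _)) => //.
- by rewrite ba.
- by move: tb; rewrite ba -natr1 => tb; lra.
- by rewrite ba -natr1; ring.
- by move=> k _; rewrite ba; lia.
- by rewrite ba.
Qed.

(** The bounds come from height 1 x >= 1 and N x_0 <= height N x = N^2; the
    values in between are taken along any monotone path. *)
Lemma first_coord_image : (0 < n)%N ->
  (@coord_form R n.+2 ord0) @` P = `[1, n.+1%:R]%classic.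
Proof.
move=> n0; apply/seteqP; split=> [t [x Px <-]|t].
  rewrite /= in_itv/= /coord_form; have x0 := fun i => secondary_ge0 i Px.
  apply/andP; split.
    have := secondary_height_ge (ltn0Sn n) Px; rewrite expr1n.
    by rewrite (@height_eq_linear _ _ _ 1%N) ?mul1r// => i; lia.
  have := height_ge_linear n.+1 x0; rewrite secondary_height_last// expr2.
  by rewrite ler_pM2l.
rewrite /= in_itv/= => t1n.
have [s [_ /(_ t t1n) [Ps s0 _ _]]] :=
  @path_section [set: 'I_n.+2]%SET n0 (finset.in_setT _) (finset.in_setT _)
    (fun i _ => finset.in_setT i).
by exists (s t).
Qed.

End Path.

(** * Integrals over intervals *)

Section Integral.
Context (R : realType).
Local Notation mu := (@lebesgue_measure R).

Lemma bounded_integrable_itv (a b M : R) (f : R -> R) :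
  measurable_fun `[a, b] f -> (forall t, a <= t <= b -> `|f t| <= M) ->
  mu.-integrable `[a, b] (EFin \o f).
Proof.
move=> mf fM; apply: measurable_bounded_integrable => //=.
  by rewrite lebesgue_measure_itv/=; case: ifPn => // _; rewrite -EFinB ltry.
exists M; split; first exact: num_real.
move=> x Mx t /=; rewrite in_itv/= => tab.
by apply: (le_trans (fM t tab)); exact: ltW.
Qed.

Lemma Rintegral_id (a b : R) : a <= b ->
  \int[mu]_(t in `[a, b]) t = (b ^+ 2 - a ^+ 2) / 2.
Proof.
rewrite le_eqVlt => /predU1P[->|ab].
  by rewrite set_itv1 Rintegral_set1 subrr mul0r.
rewrite /Rintegral (@continuous_FTC2 _ id (fun x => x ^+ 2 / 2))//=.
- by rewrite mulrBl.
- by apply: continuous_subspaceT => x; exact: cvg_id.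
- have cF : continuous (fun x : R => x ^+ 2 / 2).
    by move=> x; apply: cvgM; [exact: exprn_continuous|exact: cvg_cst].
  split=> [x _| |].
  + by apply: derivableM => //.
  + by apply: cvg_at_right_filter; exact: cF.
  + by apply: cvg_at_left_filter; exact: cF.
- move=> x _; rewrite derive1Mr// exp_derive1 expr1 -mulr_natl mulrAC.
  by rewrite divff ?mul1r.
Qed.

Lemma Rintegral_max (k N : R) : 1 <= k -> k <= N ->
  \int[mu]_(t in `[1, N]) Num.max t k = (N ^+ 2 + k ^+ 2) / 2 - k.
Proof.
move=> k1 kN.
have int a b : mu.-integrable `[a, b] (EFin \o (fun t : R => Num.max t k)).
  apply: (@bounded_integrable_itv a b (`|a| + `|b| + `|k|)).
    by apply: measurable_maxr.
  move=> t /andP[at_ tb].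
  have ha := ler_norm (- a); have hb := ler_norm b; have hk := ler_norm k.
  have hk' := ler_norm (- k); rewrite !normrN in ha hk'.
  have := normr_ge0 a; have := normr_ge0 b; have := normr_ge0 k => *.
  by rewrite ler_norml; case: (leP t k) => h; apply/andP; split; lra.
have := @Rintegral_itvB R _ (BLeft 1) (BRight N) k (int 1 N).
rewrite !bnd_simp => /(_ k1 kN)/eqP; rewrite subr_eq => /eqP ->.
rewrite Rintegral_itv_obnd_cbnd; last first.
  by apply: integrableS (int k N) => //; apply: subset_itvr; rewrite bnd_simp.
rewrite (@eq_Rintegral _ _ _ mu `[k, N]%classic id); last first.
  by move=> t; rewrite inE/= in_itv/= => /andP[kt _]; rewrite max_l.
rewrite Rintegral_id// (@eq_Rintegral _ _ _ mu `[1, k]%classic (cst k)); last first.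
  by move=> t; rewrite inE/= in_itv/= => /andP[_ tk]; rewrite max_r.
rewrite Rintegral_cst//= lebesgue_measure_itv/= lte_fin.
case: ltP => [_|k1'] /=; first by rewrite -?EFinB /=; field.
have -> : k = 1 by apply/le_anti; rewrite k1 k1'.
by field.
Qed.

Lemma Rintegral_itv_cst (a b r : R) : a <= b ->
  \int[mu]_(t in `[a, b]) r = r * (b - a).
Proof.
rewrite Rintegral_cst//= lebesgue_measure_itv/= lte_fin le_eqVlt.
by move=> /predU1P[->|->] //=; rewrite ltxx subrr.
Qed.

Lemma integrable_lincomb (I : finType) (D : set R) (w : I -> R) (f : I -> R -> R) :
  measurable D -> (forall i, mu.-integrable D (EFin \o f i)) ->
  mu.-integrable D (EFin \o (fun t => \sum_i w i * f i t)).
Proof.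
move=> mD If.
rewrite (_ : EFin \o _ = fun t => (\sum_i (w i * f i t)%:E)%E).
  apply: (@integrable_sum _ _ _ mu D mD _ _ _ (fun i t => (w i * f i t)%:E)) => i _.
  rewrite (_ : (fun t => _) = fun t => ((w i)%:E * (EFin \o f i) t)%E).
    exact: integrableZl.
  by apply/funext => t /=; rewrite EFinM.
by apply/funext => t /=; rewrite -sumEFin.
Qed.

Lemma Rintegral_lincomb (I : finType) (D : set R) (w : I -> R) (f : I -> R -> R) :
  measurable D -> (forall i, mu.-integrable D (EFin \o f i)) ->
  \int[mu]_(t in D) (\sum_i w i * f i t) = \sum_i w i * \int[mu]_(t in D) f i t.
Proof.
move=> mD If.
have Iw i : mu.-integrable D (EFin \o (fun t => w i * f i t)).
  rewrite (_ : EFin \o _ = fun t => ((w i)%:E * (EFin \o f i) t)%E).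
    exact: integrableZl.
  by apply/funext => t /=; rewrite EFinM.
elim: (index_enum I) => [|i r IH].
  under eq_Rintegral do rewrite big_nil.
  by rewrite big_nil Rintegral_cst// mul0r.
under eq_Rintegral do rewrite big_cons.
rewrite RintegralD//; first by rewrite big_cons IH RintegralZl.
rewrite (_ : EFin \o _ = fun t => (\sum_(j <- r) (w j * f j t)%:E)%E).
  by apply: (@integrable_sum _ _ _ mu D mD _ _ _ (fun j t => (w j * f j t)%:E)) => j _; exact: Iw.
by apply/funext => t /=; rewrite -sumEFin.
Qed.

End Integral.

(** * Sequences of heights *)

(** The second difference of the positive part of j - i is 1 at j = i and 0
    elsewhere. *)
Lemma height_second_difference (R : realType) (m j : nat) (x : 'rV[R]_m) (i : 'I_m) :
  i = j.+1 :> nat ->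
  height R j.+2 x + height R j x - 2 * height R j.+1 x = x 0 i.
Proof.
move=> ij; rewrite /height/= /wform mulr_sumr -big_split -sumrB/=.
rewrite (bigD1 i)//= big1 => [|k ki]; rewrite -?mulrA -mulrDl mulrA -mulrBl.
  rewrite ij subSnn (_ : (j - j.+1)%N = 0%N) ?subnn; last lia.
  by ring.
have kj : k != j.+1 :> nat by rewrite -ij.
rewrite (_ : _ - _ = 0) ?mul0r//.
have [h|h] := leqP k j; last first.
  have -> : (j - k)%N = 0%N by lia.
  have -> : (j.+1 - k)%N = 0%N by lia.
  have -> : (j.+2 - k)%N = 0%N by lia.
  by ring.
by rewrite !natrB -?natr1 -?natr1; [ring|lia|lia|lia].
Qed.

(** A positive maximum would propagate to the left, down to H 0 = 0. *)
Lemma discrete_maximum (R : realType) (N : nat) (H : nat -> R) :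
  H 0%N = 0 -> H N = 0 ->
  (forall j, (j.+1 < N)%N -> H j.+1 = 0 \/ H j.+2 + H j - 2 * H j.+1 = 0) ->
  forall j, (j <= N)%N -> H j <= 0.
Proof.
move=> H0 HN Hj j jN.
have [//=|i _ imax] := @arg_maxP _ R 'I_N.+1 ord0 xpredT (fun i => H i).
have HM k : (k <= N)%N -> H k <= H i.
  by move=> kN; exact: (imax (Ordinal (kN : (k < N.+1)%N))).
apply: le_trans (HM j jN) _; rewrite leNgt; apply/negP => M0.
suff neM : forall k, (k <= N)%N -> H k != H i by have := neM i (leq_ord i); rewrite eqxx.
elim=> [_|k IH kN]; first by rewrite H0 lt_eqF.
apply/eqP => e; have kN' : (k.+1 < N)%N.
  rewrite ltn_neqAle kN andbT; apply/eqP => ek.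
  by move: M0; rewrite -e ek HN ltxx.
have [h|h] := Hj k kN'; first by move: M0; rewrite -e h ltxx.
have := HM k.+2 kN'; have := HM k (ltnW kN); have := IH (ltnW kN).
by rewrite e in h => /eqP; lra.
Qed.

Lemma discrete_uniqueness (R : realType) (N : nat) (H : nat -> R) :
  H 0%N = 0 -> H N = 0 ->
  (forall j, (j.+1 < N)%N -> H j.+1 = 0 \/ H j.+2 + H j - 2 * H j.+1 = 0) ->
  forall j, (j <= N)%N -> H j = 0.
Proof.
move=> H0 HN Hj j jN; apply/le_anti; rewrite (discrete_maximum H0 HN)//=.
rewrite -oppr_le0; apply: (@discrete_maximum _ N (fun j => - H j)) => //.
- by rewrite H0 oppr0.
- by rewrite HN oppr0.
- by move=> k kN; have [h|h] := Hj k kN; [left; rewrite h oppr0|right; lra].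
Qed.

Lemma height0 (R : realType) m (x : 'rV[R]_m) : height R 0 x = 0.
Proof. by rewrite /height/= /wform big1// => i _; rewrite sub0n mul0r. Qed.

Lemma height1 (R : realType) n (x : 'rV[R]_n.+2) : height R 1 x = x 0 ord0.
Proof. by rewrite height_eq_linear ?mul1r// => i; lia. Qed.

(** The heights of d vanish by the maximum principle, being linear near each
    index outside K; the coordinates of d are their second differences, except
    the last one, which is given by the vanishing sum. *)
Lemma row_uniqueness (R : realType) (n : nat) (K : {set 'I_n.+2}) (d : 'rV[R]_n.+2) :
  ord_max \in K -> d 0 ord0 = 0 -> coord_sum R d = 0 ->
  (forall i, i \notin K -> d 0 i = 0) ->
  (forall i : 'I_n.+2, i \in K -> (0 < i)%N -> height R i d = 0) -> d = 0.
Proof.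
move=> Km d0 td dK hK.
have H0 : forall j, (j <= n.+1)%N -> height R j d = 0.
  apply: discrete_uniqueness; first exact: height0.
    exact: (hK ord_max).
  move=> j jn; have jn' : (j.+1 < n.+2)%N by exact: ltnW.
  rewrite (@height_second_difference _ _ _ _ (Ordinal jn'))//.
  have [iK|iK] := boolP (Ordinal jn' \in K); [left; exact: (hK (Ordinal jn'))|right].
  exact: dK.
have dlt i : i != ord_max -> d 0 i = 0.
  move=> im; have [->//|] := eqVneq i ord0; rewrite -val_eqE/= -lt0n => i0.
  have ilt : (i < n.+1)%N by rewrite ltn_neqAle im leq_ord.
  rewrite -(@height_second_difference _ _ i.-1); last by rewrite prednK.
  by rewrite !prednK// !H0; [ring|exact: ltnW|lia|].
apply/rowP => i; rewrite mxE; have [->|/dlt//] := eqVneq i ord_max.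
move: td; rewrite /coord_sum/= /wform (bigD1 ord_max)//= big1 ?addr0 ?mul1r//.
by move=> k /dlt ->; rewrite mulr0.
Qed.

(** * Means of sections *)

Section FiberPolytope.
Context (R : realType) (n : nat) (n0 : (0 < n)%N).
Local Notation P := (secondary_polytope R n).
Local Notation N := (n.+1).
Local Notation mu := (@lebesgue_measure R).
Local Notation D := (`[(1 : R), (N%:R : R)]%classic).

Let nR : N%:R - 1 = n%:R :> R. Proof. by rewrite -natr1 addrK. Qed.
Let nR0 : (n%:R : R) != 0. Proof. by rewrite pnatr_eq0 -lt0n. Qed.
Let N1 : (1 : R) <= N%:R. Proof. by rewrite ler1n. Qed.

(** The mean over t in [1, N] of j max (t, j). *)
Definition level (j : nat) : R :=
  j%:R * ((N%:R ^+ 2 + j%:R ^+ 2) / 2 - j%:R) / n%:R.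

Lemma level_second_difference j : level j.+2 + level j - 2 * level j.+1 = (3 * j + 1)%:R / n%:R.
Proof.
rewrite /level -(@natr1 R j.+1) -!(@natr1 R j) natrD natrM.
by field.
Qed.

Lemma level_last : level N = N%:R ^+ 2.
Proof. by rewrite /level -nR; field; rewrite addrAC subrr add0r. Qed.

Definition average (s : R -> 'rV[R]_n.+2) : 'rV[R]_n.+2 :=
  \row_i ((\int[mu]_(t in D) s t 0 i) / n%:R).

Definition section_of (s : R -> 'rV[R]_n.+2) : Prop :=
  (forall i, measurable_fun D (fun t => s t 0 i)) /\
  (forall t, D t -> P (s t) /\ s t 0 ord0 = t).

Local Notation Q := [set average s | s in section_of].

Lemma monotone_path_polytopeE :
  monotone_path_polytope P (@coord_form R n.+2 ord0) = Q.
Proof.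
rewrite /monotone_path_polytope first_coord_image//.
have -> : fine (mu D) = n%:R.
  rewrite lebesgue_measure_itv/= lte_fin -nR.
  by rewrite -(@natr1 R n) ltrDr ltr0n n0.
rewrite /is_section first_coord_image//.
Qed.

Lemma section_bound s t i : section_of s -> D t -> 0 <= s t 0 i <= N%:R *+ 2.
Proof.
move=> [_ sP] Dt; have [Ps _] := sP t Dt; rewrite secondary_ge0//=.
rewrite -(secondary_coord_sum Ps) /coord_sum/= /wform (bigD1 i)//= mul1r lerDl.
by rewrite sumr_ge0// => k _; rewrite mul1r secondary_ge0.
Qed.

Lemma section_integrable s i : section_of s ->
  mu.-integrable D (EFin \o (fun t => s t 0 i)).
Proof.
move=> sP; apply: (@bounded_integrable_itv _ _ _ (N%:R *+ 2)); first by case: sP.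
move=> t tD; have /andP[h1 h2] : 0 <= s t 0 i <= N%:R *+ 2.
  by apply: section_bound => //; rewrite /= in_itv.
by rewrite ger0_norm.
Qed.

Lemma average_wform s w : section_of s ->
  wform w (average s) = (\int[mu]_(t in D) wform w (s t)) / n%:R.
Proof.
move=> sP; rewrite /wform Rintegral_lincomb//; last first.
  by move=> i; exact: section_integrable.
by rewrite mulr_suml; apply: eq_bigr => i _; rewrite mxE mulrA.
Qed.

Lemma average_wform_cst s w b : section_of s ->
  (forall t, D t -> wform w (s t) = b) -> wform w (average s) = b.
Proof.
move=> sP wb; rewrite average_wform//.
rewrite (@eq_Rintegral _ _ _ mu D (cst b)); last by move=> t; rewrite inE => /wb.
by rewrite /cst Rintegral_itv_cst// nR mulfK.
Qed.

Lemma Rintegral_level (j : nat) : (0 < j)%N -> (j <= N)%N ->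
  (\int[mu]_(t in D) (j%:R * Num.max t j%:R)) / n%:R = level j.
Proof.
move=> j0 jN; rewrite RintegralZl//.
  by rewrite Rintegral_max ?ler1n ?ler_nat.
apply: (@bounded_integrable_itv _ _ _ N%:R); first by apply: measurable_maxr.
move=> t /andP[t1 tN]; rewrite ger0_norm.
  by rewrite ge_max tN ler_nat.
by rewrite le_max ler0n orbT.
Qed.

(** A convex sequence with first values 0 and t lies above the line j t, and the
    heights on the secondary polytope lie above the parabola j^2. *)
Lemma average_height_ge s (j : nat) : section_of s -> (0 < j)%N -> (j <= N)%N ->
  level j <= height R j (average s).
Proof.
move=> sP j0 jN; rewrite /height/= average_wform// -Rintegral_level//.
rewrite ler_pM2r ?invr_gt0 ?ltr0n//.
apply: le_Rintegral => //.
- apply: (@bounded_integrable_itv _ _ _ (j%:R * N%:R)).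
    by apply: measurable_funM => //; apply: measurable_maxr.
  move=> t /andP[t1 tN]; rewrite ger0_norm.
    by rewrite ler_wpM2l// ge_max tN ler_nat.
  by rewrite mulr_ge0// le_max ler0n orbT.
- by apply: integrable_lincomb => // i; exact: section_integrable.
- move=> t Dt; case: sP => _ /(_ t Dt) [Ps s0].
  have h1 := secondary_height_ge jN Ps.
  have h2 := height_ge_linear j (fun i => secondary_ge0 i Ps).
  rewrite s0 in h2; rewrite expr2 in h1.
  by case: (leP t j%:R).
Qed.

Lemma average_height_eq s (j : nat) : section_of s -> (0 < j)%N -> (j <= N)%N ->
  (forall t, D t -> height R j (s t) = j%:R * Num.max t j%:R) ->
  height R j (average s) = level j.
Proof.
move=> sP j0 jN h; rewrite /height/= average_wform// -Rintegral_level//.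
by congr (_ / _); apply: eq_Rintegral => t; rewrite inE => /h.
Qed.

Lemma average_first s : section_of s -> average s 0 ord0 = level 1.
Proof.
move=> sP; rewrite -height1; apply: average_height_eq => // t Dt.
case: sP => _ /(_ t Dt) [_ s0]; rewrite height1 s0 mul1r max_l//.
by move: Dt; rewrite /= in_itv/= => /andP[].
Qed.

(** Convex combinations of sections are sections. *)
Lemma average_convex x y r : Q x -> Q y -> 0 <= r <= 1 -> Q (x + r *: (y - x)).
Proof.
move=> [s sP <-] [u uP <-] r01.
have suP : section_of (fun t => s t + r *: (u t - s t)).
  split=> [i|t Dt].
    apply: (eq_measurable_fun (fun t => s t 0 i + r * (u t 0 i - s t 0 i))).
      by move=> t _; rewrite !mxE.
    case: sP uP => [ms _] [mu_ _].
    by apply: measurable_funD => //; apply: measurable_funM => //; apply: measurable_funB.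
  have [Ps s0] := sP.2 t Dt; have [Pu u0] := uP.2 t Dt.
  split; first exact: convex_hull_conv.
  by rewrite !mxE s0 u0 subrr mulr0 addr0.
exists (fun t => s t + r *: (u t - s t)) => //.
apply/rowP => i; rewrite !mxE.
under eq_Rintegral do rewrite !mxE.
have Is := section_integrable i sP; have Iu := section_integrable i uP.
have Id : mu.-integrable D (EFin \o (fun t => u t 0 i - s t 0 i)).
  rewrite (_ : EFin \o _ = fun t => ((u t 0 i)%:E - (s t 0 i)%:E)%E).
    by apply: integrableB.
  by apply/funext => t /=; rewrite EFinB.
rewrite RintegralD//; last first.
  rewrite (_ : EFin \o _ = fun t => (r%:E * (EFin \o (fun t => u t 0 i - s t 0 i)%R) t)%E).
    exact: integrableZl.
  by apply/funext => t /=; rewrite EFinM.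
rewrite RintegralZl// RintegralB//.
by rewrite mulrDl mulrBr mulrBr !mulrBl !mulrA.
Qed.

End FiberPolytope.

(** * Inequalities for the fiber polytope *)

Section Description.
Context (R : realType) (n : nat) (n0 : (0 < n)%N).
Local Notation N := (n.+1).
Local Notation D := (`[(1 : R), (N%:R : R)]%classic).
Local Notation Q := [set average s | s in @section_of R n].
Local Notation level := (level R n).

Definition interior_point (j : 'I_n.-1) : 'I_n.+2 := inord j.+2.

Lemma interior_pointE j : interior_point j = j.+2 :> nat.
Proof. by rewrite inordK//; have := ltn_ord j; lia. Qed.

Lemma interior_point_lt j : (1 < interior_point j < N)%N.
Proof. by rewrite interior_pointE; have := ltn_ord j; lia. Qed.

Lemma interior_pointP (i : 'I_n.+2) : (1 < i < N)%N -> exists j, i = interior_point j.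
Proof.
move=> /andP[i1 iN]; have h : (i.-2 < n.-1)%N by lia.
by exists (Ordinal h); apply/ord_inj; rewrite interior_pointE/=; lia.
Qed.

(** [level 1] is the mean of the slopes t, since max (t, 1) = t on [1, N]. *)
Definition fiber_space : set 'rV[R]_n.+2 :=
  [set x : 'rV[R]_n.+2 | [/\ x 0 ord0 = level 1, coord_sum R x = N%:R *+ 2 &
               height R N x = N%:R ^+ 2]].

(** The pair indexed by j consists of height >= level, for [true], and
    coordinate >= 0, for [false]: the two opposite facets in direction j. *)
Definition fiber_form (b : bool * 'I_n.-1) : {scalar 'rV[R]_n.+2} :=
  if b.1 then height R (interior_point b.2) else coord_form (interior_point b.2).

Definition fiber_bound (b : bool * 'I_n.-1) : R :=
  if b.1 then level (interior_point b.2) else 0.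

Local Notation H := (polyhedron fiber_space fiber_form fiber_bound).
Local Notation tightQ := (tight fiber_form fiber_bound).

Lemma fiber_space_affine : affine_set fiber_space.
Proof.
move=> x y r [x0 xt xN] [y0 yt yN]; split.
- by rewrite !mxE x0 y0; ring.
- by rewrite linearD linearZ linearB/= xt yt; ring.
- by rewrite linearD linearZ linearB/= xN yN; ring.
Qed.

Lemma average_in_polyhedron : Q `<=` H.
Proof.
move=> _ [s sP <-]; split; [split|].
- exact: average_first.
- by apply: average_wform_cst => // t Dt; apply: secondary_coord_sum; case: sP => _ /(_ t Dt)[].
- by apply: average_wform_cst => // t Dt; apply: secondary_height_last; case: sP => _ /(_ t Dt)[].
- move=> [[] j]; rewrite /fiber_bound /fiber_form/=.
    have /andP[j1 jN] := interior_point_lt j.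
    by apply: average_height_ge => //; exact: ltnW.
  rewrite /coord_form mxE divr_ge0// Rintegral_ge0// => t Dt.
  by have /andP[] := section_bound (interior_point j) sP Dt.
Qed.

(** The inequality extends to j = 1 and j = N, where the equations of the affine
    space turn it into an equality. *)
Lemma polyhedron_height x (j : nat) : H x -> (0 < j)%N -> (j <= N)%N ->
  level j <= height R j x.
Proof.
move=> [[x0 _ xN] xb] j0 jN.
have [j1|j1] := leqP j 1.
  by rewrite (_ : j = 1%N) ?height1 ?x0//; lia.
move: jN; rewrite leq_eqVlt => /predU1P[->|jN]; first by rewrite xN level_last.
have jlt : (j < n.+2)%N by exact: ltnW.
have [|i ji] := @interior_pointP (Ordinal jlt); first by rewrite /= j1.
by have := xb (true, i); rewrite /fiber_bound /fiber_form/= -ji.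
Qed.

(** If x_j = 0 the heights are linear near j, while the levels are strictly
    convex there: the height at j is at least the mean of the neighbouring levels,
    which exceeds the level at j. *)
Lemma not_both_tight x j : H x -> x 0 (interior_point j) = 0 ->
  level (interior_point j) < height R (interior_point j) x.
Proof.
move=> Hx xj.
have /andP[j1 jN] := interior_point_lt j.
have jE := interior_pointE j.
have := height_second_difference x jE; rewrite xj.
rewrite jE in j1 jN *.
have h1 := @polyhedron_height x j.+1 Hx isT (ltnW (ltnW jN)).
have h2 := @polyhedron_height x j.+3 Hx isT jN.
have := level_second_difference R n0 j.+1.
have : 0 < (3 * j.+1 + 1)%:R / n%:R :> R by rewrite divr_gt0 ?ltr0n ?addn1.
lra.
Qed.

(** The index 1 belongs to K because slope 1 is the least value: all monotone
    paths start on the facet of triangulations with vertex 1. *)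
Definition support_set (K : {set 'I_n.+2}) : Prop :=
  [/\ ord0 \in K, ord_max \in K & forall i : 'I_n.+2, i = 1%N :> nat -> i \in K].

Lemma exists_vertex (K : {set 'I_n.+2}) : support_set K ->
  exists2 x, Q x & (forall i, i \notin K -> x 0 i = 0) /\
    (forall k : 'I_n.+2, k \in K -> (0 < k)%N -> height R k x = level k).
Proof.
move=> [K0 Km K1]; have [s [ms sK]] := @path_section R n K n0 K0 Km K1.
have sP : section_of s.
  split=> [i|t Dt]; first exact: measurable_funTS.
  by have [|] := sK t; first by move: Dt; rewrite /= in_itv.
exists (average s); first by exists s.
split=> [i iK|k kK k0].
  rewrite mxE (@eq_Rintegral _ _ _ (@lebesgue_measure R) D (cst 0)).
    by rewrite /cst Rintegral_itv_cst ?mul0r// ler1n.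
  by move=> t; rewrite inE /= in_itv/= => /sK[_ _ h _]; rewrite h.
apply: average_height_eq => //; first exact: leq_ord.
by move=> t; rewrite /= in_itv/= => /sK[_ _ _ h]; rewrite h.
Qed.

(** The points where the heights of x can bend, with 0, 1 and N added. *)
Definition visible (x : 'rV[R]_n.+2) : {set 'I_n.+2} :=
  [set i : 'I_n.+2 | [|| (i <= 1)%N, i == ord_max | x 0 i != 0]]%SET.

Lemma visible_support x : support_set (visible x).
Proof.
split; [by rewrite inE|by rewrite inE eqxx orbT|].
by move=> i i1; rewrite inE i1.
Qed.

Lemma wform_delta (w : 'I_n.+2 -> R) i : wform w (delta_mx 0 i) = w i.
Proof.
rewrite /wform (bigD1 i)//= mxE !eqxx mulr1 big1 ?addr0// => k ki.
by rewrite mxE (negbTE ki) andbF mulr0.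
Qed.

(** If every pair has a tight inequality, x is the vertex given by its
    breakpoints.  Otherwise let l be an index with none and p < l < q the
    breakpoints next to l.  Adding multiples of the sequence with bends at p, l
    and q only, which is a hat supported in [p, q], changes none of the tight
    equalities, lowers one slack at l and raises the other one. *)
Lemma polyhedron_sub_average : H `<=` Q.
Proof.
apply: polyhedron_sub_convex; first exact: average_convex.
move=> x Hx; have [[x0 xt xN] xb] := Hx.
case: (pselect (forall j, (false, j) \in tightQ x \/ (true, j) \in tightQ x)) => [full|].
  left; have [K0 Km K1] := visible_support x.
  have [y Qy [yK yh]] := exists_vertex (visible_support x).
  have Hy := average_in_polyhedron Qy; have [[y0 yt yN] _] := Hy.
  suff -> : x = y by [].
  apply/eqP; rewrite -subr_eq0; apply/eqP; apply: (row_uniqueness Km).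
  - by rewrite !mxE x0 y0 subrr.
  - by rewrite linearB/= xt yt subrr.
  - move=> i iK; rewrite !mxE yK// subr0; move: iK; rewrite inE !negb_or negbK.
    by move=> /and3P[_ _ /eqP].
  - move=> i iK i0; rewrite linearB/= yh//.
    have [->|im] := eqVneq i ord_max; first by rewrite /= xN level_last// subrr.
    have [i1|i1] := leqP i 1.
      have -> : (i : nat) = 1%N by apply/eqP; rewrite eqn_leq i1 i0.
      by rewrite height1 x0 subrr.
    have [|j ij] := @interior_pointP i.
      by rewrite i1/= ltn_neqAle -val_eqE/= in im *; rewrite im leq_ord.
    have [/tightP h|/tightP h] := full j.
      move: iK; rewrite inE leqNgt i1 (negbTE im)/=.
      by move: h; rewrite /fiber_form /fiber_bound/= /coord_form -ij => ->; rewrite eqxx.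
    by move: h; rewrite /fiber_form /fiber_bound/= -ij => ->; rewrite subrr.
move=> /existsNP[j /not_orP[]] /negP jf /negP jt; right.
set l := interior_point j.
have /andP[l1 lN] : (1 < l < N)%N := interior_point_lt j.
have [K0 Km K1] := visible_support x; set K := visible x in K0 Km K1.
have xl : 0 < x 0 l by have := tight_slack Hx jf.
have [p [pK pl pmax]] := @last_before n K (fun i => (i < l)%N) K0 (ltnW l1).
have [q [qK lq qmin]] := @first_after n K (fun i => (l < i)%N) Km lN.
have p0 : (0 < p)%N.
  have n1 : (1 < n.+2)%N by [].
  by have := pmax (Ordinal n1) (K1 (Ordinal n1) erefl) l1.
have plR : (p%:R : R) < l%:R by rewrite ltr_nat.
have lqR : (l%:R : R) < q%:R by rewrite ltr_nat.
pose v : 'rV[R]_n.+2 := (q%:R - l%:R) *: delta_mx 0 p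
  - (q%:R - p%:R) *: delta_mx 0 l + (l%:R - p%:R) *: delta_mx 0 q.
have wv (w : 'I_n.+2 -> R) : wform w v =
    (q%:R - l%:R) * w p - (q%:R - p%:R) * w l + (l%:R - p%:R) * w q.
  by rewrite /v linearD linearB !linearZ/= !wform_delta.
have vi i : v 0 i = (q%:R - l%:R) * (i == p)%:R - (q%:R - p%:R) * (i == l)%:R
    + (l%:R - p%:R) * (i == q)%:R.
  by rewrite !mxE.
have hv_lo (k : nat) : (k <= p)%N -> height R k v = 0.
  move=> kp; rewrite /height/= wv.
  have -> : (k - p)%N = 0%N by lia.
  have -> : (k - l)%N = 0%N by lia.
  have -> : (k - q)%N = 0%N by lia.
  by ring.
have hv_hi (k : nat) : (q <= k)%N -> height R k v = 0.
  by move=> qk; rewrite /height/= wv !natrB; [ring|lia|lia|lia].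
exists v; split.
- move=> r; split.
  + rewrite !mxE x0 -!val_eqE/=.
    have -> : (0%N == p) = false by lia.
    have -> : (0%N == l) = false by lia.
    have -> : (0%N == q) = false by lia.
    by ring.
  + by rewrite linearD linearZ/= xt wv; ring.
  + by rewrite linearD linearZ/= xN hv_hi ?mulr0 ?addr0// leq_ord.
- move=> [[] i] /[dup] it /tightP; rewrite /fiber_form /fiber_bound/=.
    move=> hi.
    have iK : interior_point i \in K.
      rewrite inE; apply/or3P/Or33/negP => /eqP xi.
      by have := not_both_tight Hx xi; rewrite [X in _ < X]hi ltxx.
    have il : interior_point i != l.
      apply: contra jt => /eqP /(congr1 (nat_of_ord (n:=_))).
      by rewrite /l !interior_pointE => -[/val_inj <-].
    have [h|h] := ltnP (interior_point i) l; first exact/hv_lo/pmax.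
    apply/hv_hi/qmin => //; rewrite ltn_neqAle h andbT eq_sym.
    by rewrite val_eqE.
  rewrite /coord_form => xi.
  have iK : interior_point i \notin K.
    have /andP[i1 iN] := interior_point_lt i.
    by rewrite inE xi eqxx orbF negb_or -ltnNge i1/= -val_eqE/= ltn_eqF.
  rewrite vi.
  have -> : (interior_point i == p) = false by apply: contraNF iK => /eqP ->.
  have -> : (interior_point i == q) = false by apply: contraNF iK => /eqP ->.
  have -> : (interior_point i == l) = false.
    by apply/eqP => e; move: xl; rewrite -e xi ltxx.
  by ring.
- exists (false, j); rewrite /fiber_form/= /coord_form -/l vi eqxx.
  have -> : (l == p) = false by rewrite -val_eqE/= gtn_eqF.
  have -> : (l == q) = false by rewrite -val_eqE/= ltn_eqF.
  by rewrite mulr0n mulr1n !mulr0 mulr1 sub0r addr0 oppr_lt0; lra.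
- exists (true, j); rewrite /fiber_form -/l /height/= wv subnn.
  have -> : (l - q)%N = 0%N by lia.
  rewrite natrB; last exact: ltnW.
  by rewrite !mulr0 subr0 addr0 mulr_gt0 ?subr_gt0.
Qed.

(** Of the inequalities at j, one is an equality by the choice of the vertex, and
    then the other one is strict. *)
Lemma vertex_tight (K : {set 'I_n.+2}) : support_set K ->
  exists2 x, H x & tightQ x =
    [set b | if b.1 then interior_point b.2 \in K else interior_point b.2 \notin K]%SET.
Proof.
move=> /exists_vertex[x Qx [xK xh]]; have Hx := average_in_polyhedron Qx.
exists x => //; apply/setP => -[c j].
apply/tightP/idP; rewrite inE; case: c; rewrite /fiber_form /fiber_bound/= /coord_form.
- move=> h; apply/negPn/negP => /xK /(not_both_tight Hx).
  by rewrite [X in _ < X]h ltxx.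
- move=> h; apply/negP => jK.
  have /andP[j1 _] := interior_point_lt j.
  by have := not_both_tight Hx h; rewrite xh ?ltxx// ltnW.
- by move=> jK; have /andP[j1 _] := interior_point_lt j; rewrite xh// ltnW.
- exact: xK.
Qed.

Definition cube_form (b : bool * 'I_n.-1) : {scalar 'rV[R]_n.-1} :=
  let e : {scalar 'rV[R]_n.-1} := coord_form b.2 in
  if b.1 then \- e : {scalar 'rV[R]_n.-1} else e.

Definition cube_bound (b : bool * 'I_n.-1) : R := if b.1 then -1 else 0.

Lemma cube_formE b y : cube_form b y = if b.1 then - y 0 b.2 else y 0 b.2.
Proof. by case: b => -[]. Qed.

Lemma cubeE : cube R n.-1 = polyhedron setT cube_form cube_bound.
Proof.
apply/seteqP; split=> y.
  move=> y01; split=> // -[[] j]; rewrite cube_formE /cube_bound/=;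
  by have /andP[] := y01 j; rewrite ?lerN2.
move=> [_ h] j; have := h (false, j); have := h (true, j).
by rewrite !cube_formE /cube_bound/= lerN2 => -> ->.
Qed.

Lemma tight_cube y b : (b \in tight cube_form cube_bound y) =
  (y 0 b.2 == if b.1 then 1 else 0).
Proof. by rewrite inE cube_formE /cube_bound; case: b.1 => //; rewrite eqr_opp. Qed.

Lemma polyhedron_equivalent_cube :
  combinatorially_equivalent H (cube R n.-1).
Proof.
rewrite cubeE; apply: combinatorially_equivalent_tight => //.
- exact: fiber_space_affine.
- move=> x Hx.
  pose y : 'rV[R]_n.-1 := \row_j
    (if (false, j) \in tightQ x then 0 else if (true, j) \in tightQ x then 1 else 2^-1).
  have half0 : (2^-1 : R) != 0 by rewrite invr_eq0 pnatr_eq0.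
  have half1 : (2^-1 : R) != 1 by rewrite invr_eq1 (eqr_nat _ 2 1).
  exists y.
    rewrite -cubeE => j; rewrite mxE; case: ifP => _; first by rewrite lexx ler01.
    case: ifP => _; first by rewrite lexx ler01.
    by rewrite invr_ge0 ler0n invf_le1 ?ltr0n// ler1n.
  apply/setP => -[c j]; rewrite tight_cube mxE/=; case: c.
    case: ifP => [/tightP h|_].
      rewrite eq_sym oner_eq0; apply/esym/negP => /tightP.
      by move=> h'; have := not_both_tight Hx h; rewrite [X in _ < X]h' ltxx.
    by case: ifP; rewrite ?eqxx// (negbTE half1).
  by case: ifP; rewrite ?eqxx//; case: ifP; rewrite ?oner_eq0// (negbTE half0).
- move=> y _.
  have [K KP inK] : exists2 K : {set 'I_n.-1} -> {set 'I_n.+2},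
      forall B, support_set (K B) & forall B j, (interior_point j \in K B) = (j \in B).
    exists (fun B : {set 'I_n.-1} => [set i : 'I_n.+2 | (i <= 1)%N || (i == ord_max)] :|:
                     (interior_point @: B))%SET => [B|B j].
      by split=> [||i i1]; rewrite !inE ?eqxx ?orbT ?i1.
    have /andP[j1 jN] := interior_point_lt j.
    rewrite inE [X in X || _]inE leqNgt j1 -val_eqE/= ltn_eqF//=.
    rewrite mem_imset// => i k /(congr1 (nat_of_ord (n:=_))).
    by rewrite !interior_pointE => -[/val_inj].
  (* The midpoint of two vertices keeps the equalities they share: these are
     the height equality where y_j = 1 and the coordinate equality where
     y_j = 0. *)
  have [x Hx tx] := vertex_tight (KP [set j | y 0 j == 1]%SET).
  have [z Hz tz] := vertex_tight (KP [set j | y 0 j != 0]%SET).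
  have [Hm tm] := midpoint_tight fiber_space_affine Hx Hz.
  exists (x + 2^-1 *: (z - x)) => //.
  apply/setP => -[c j]; rewrite tm tight_cube inE tx tz !inE/= !inK !inE.
  case: c => /=; rewrite ?negbK.
    by case: eqP => // ->; rewrite oner_eq0.
  by case: (eqVneq (y 0 j) 0) => [->|]; rewrite ?andbF// eq_sym oner_eq0.
Qed.

End Description.

Theorem proposition3p4 (R : realType) (n : nat) (hn : (1 <= n)%N) :
  combinatorially_equivalent
    (monotone_path_polytope (secondary_polytope R n)
       (@coord_form R n.+2 ord0))
    (cube R n.-1).
Proof.
rewrite monotone_path_polytopeE//.
rewrite (_ : [set _ | _ in _] =
  polyhedron (@fiber_space R n) (@fiber_form R n) (@fiber_bound R n)).
  exact: polyhedron_equivalent_cube.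
by apply/seteqP; split; [exact: average_in_polyhedron|exact: polyhedron_sub_average].
Qed.
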